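(* Let $\alpha, \beta \in (0,1)$ with $\alpha$ irrational. The gaps between successive integers $i \ge 0$ for which $\{i\alpha\} < \beta$ have at most three distinct values; when three distinct values occur, one of them is the sum of the other two. More precisely: (1) If $\beta \ge \max(\alpha, 1-\alpha)$, the possible gaps are $1$ and $2$: - the gap $1$ occurs with frequency $(2\beta - 1)/\beta$, - the gap $2$ occurs with frequency $(1-\beta)/\beta$. (2) If $\beta < \max(\alpha, 1-\alpha)$, let $b$ and $d$ be the smallest positive integers satisfying, respectively, $$\{b\alpha\} < \beta, \qquad \{d\alpha\} > 1 - \beta.$$ Then the possible gaps are $b$, $d$ and $b+d$. Letting $s = \{b\alpha\}$ and $t = 1 - \{d\alpha\}$: - the gap $b$ occurs with frequency $(\beta - s)/\beta$, - the gap $d$ occurs with frequency $(\beta - t)/\beta$, - the gap $b+d$ occurs with frequency $(s+t-\beta)/\beta$, where the last case arises when $s+t > \beta$.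
   Context: For real $x$, $\{x\} := x - \lfloor x \rfloor$ is the fractional part, where $\lfloor x\rfloor$ is the largest integer not exceeding $x$. Let $I = \{ i \in \mathbb{Z}_{\ge 0} : \{i\alpha\} < \beta\}$. For $i \in I$, the gap after $i$ is $i' - i$, where $i'$ is the smallest element of $I$ greater than $i$. The frequency of a gap $g$ is its asymptotic relative frequency among the elements of $I$, i.e. $\lim_{N\to\infty} \frac{\#\{ i \in I : i \le N,\ \text{the gap after } i \text{ is } g\}}{\#\{ i \in I : i \le N\}}$. *)

(* Defs.v *)
From HB Require Import structures.
From mathcomp Require Import all_boot all_order all_algebra.
From mathcomp Require Import all_classical all_reals all_analysis.

Set Implicit Arguments.
Unset Strict Implicit.
Unset Printing Implicit Defensive.

Import Order.TTheory GRing.Theory Num.Theory.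
Import numFieldNormedType.Exports.

Local Open Scope classical_set_scope.
Local Open Scope ring_scope.

Definition fracpart (R : realType) (x : R) : R := x - (Num.floor x)%:~R.

Definition least_elt (A : set nat) (n : nat) : Prop :=
  A n /\ forall m, A m -> (n <= m)%N.

Definition hits (R : realType) (alpha beta : R) : set nat :=
  [set i | fracpart (i%:R * alpha) < beta].

(* The successor i' is i + g, so that g = i' - i without truncated subtraction;
   i' > i forces g > 0. *)
Definition gap_after (R : realType) (alpha beta : R) (i g : nat) : Prop :=
  least_elt [set j | hits alpha beta j /\ (i < j)%N] (i + g).

Definition gaps (R : realType) (alpha beta : R) : set nat :=
  [set g | exists2 i, hits alpha beta i & gap_after alpha beta i g].

Definition count_upto (P : nat -> Prop) (N : nat) : nat :=
  count (fun i => `[< P i >]) (iota 0 N.+1).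

Definition gap_frequency (R : realType) (alpha beta : R) (g : nat) (f : R) : Prop :=
  (fun N => (count_upto
               (fun i => hits alpha beta i /\ gap_after alpha beta i g) N)%:R
            / (count_upto (hits alpha beta) N)%:R : R) @ \oo --> f.

(* Main.v *)
Require Import Defs.
From mathcomp Require Import all_boot all_order all_algebra.
From mathcomp Require Import ring lra zify.
From mathcomp Require Import all_classical all_reals all_analysis.

(** Write [x_i] for the fractional part of [i * alpha].  Moving from index [i]
    to [i + g] adds [x_g] to [x_i] modulo 1 ([orbitD]), so the question is how
    a point [x] of [[0, beta)] under the rotation by [alpha] first returns to
    [[0, beta)].

    A return that raises [x] uses a [g] with [x_g < beta], so [g >= b]; a
    return that lowers it uses a [g] with [x_g > 1 - beta], so [g >= d].  The
    first available rise is [s = x_b], the first available fall is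
    [t = 1 - x_d].  The rise keeps [x] below [beta] exactly when
    [x < beta - s], the fall keeps it nonnegative exactly when [x >= t], and
    minimality of [b] and [d] forces [beta <= s + t], so these two zones are
    disjoint.  For [x] in the middle zone [[beta - s, t)], a rise smaller than
    [s] or a fall smaller than [t] is needed.  Subtracting [b] from the index
    of such a rise leaves the index of a fall, and subtracting [d] from the
    index of such a fall leaves the index of a rise, so the gap is at least
    [b + d]; and [b + d] does return.  Hence the gap after [i] is read off
    from the zone of [x_i] ([return_timeP]).  When
    [beta >= max (alpha, 1 - alpha)] the same three zones work with
    [b = d = 1], [s = alpha], [t = 1 - alpha], even if this [s] or [t] equals
    [beta]: the outer zones both give the gap 1, the middle one the gap 2.

    Frequencies are then lengths of zones divided by [beta], once the [x_i]
    are known to be equidistributed ([orbit_equidistributed]).  For an interval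
    [[0, x_q)] this is exact up to a bounded error: the translation by [x_q]
    wraps around precisely when the new point lies in [[0, x_q)], so the
    indicator of this event is [x_q + x_n - x_(n+q)], whose sum over [n] is
    [N * x_q] plus a telescoping remainder of size at most [q]; replacing
    [n + q] by [n] in the count costs at most another [q].  Since the [x_q] are
    dense ([orbit_dense]), counts for an arbitrary interval [[0, c)]
    are squeezed between such exact ones.  A gap of positive frequency occurs,
    which gives the existence claims. *)

Set Implicit Arguments.
Unset Strict Implicit.
Unset Printing Implicit Defensive.

Import Order.TTheory GRing.Theory Num.Theory.
Import numFieldNormedType.Exports.

Local Open Scope classical_set_scope.
Local Open Scope ring_scope.

(** * The orbit of a rotation *)

Definition orbit (R : realType) (alpha : R) (n : nat) : R :=
  fracpart (n%:R * alpha).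

Lemma fracpart_unique (R : realType) (x y : R) (k : int) :
  0 <= y < 1 -> x = y + k%:~R -> fracpart x = y.
Proof.
move=> /andP[y0 y1] ->; rewrite /fracpart.
rewrite (_ : Num.floor (y + k%:~R) = k) ?addrK//.
by apply: floor_def; rewrite intrD; apply/andP; split; lra.
Qed.

Lemma orbit_itv (R : realType) (alpha : R) (n : nat) : 0 <= orbit alpha n < 1.
Proof.
rewrite /orbit /fracpart; have := floor_itv (n%:R * alpha).
by rewrite intrD => /andP[? ?]; apply/andP; split; lra.
Qed.

Lemma orbitD (R : realType) (alpha : R) (m n : nat) :
  orbit alpha (m + n) = orbit alpha m + orbit alpha n \/
  orbit alpha (m + n) = orbit alpha m + orbit alpha n - 1.
Proof.
have /andP[m0 m1] := orbit_itv alpha m; have /andP[n0 n1] := orbit_itv alpha n.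
have E k : k%:R * alpha = orbit alpha k + (Num.floor (k%:R * alpha))%:~R.
  by rewrite /orbit /fracpart subrK.
have [lt1|ge1] := ltP (orbit alpha m + orbit alpha n) 1; [left|right].
- apply: (@fracpart_unique _ _ _
    (Num.floor (m%:R * alpha) + Num.floor (n%:R * alpha))).
    by apply/andP; split; lra.
  by have := E m; have := E n; rewrite natrD mulrDl intrD; lra.
- apply: (@fracpart_unique _ _ _
    (Num.floor (m%:R * alpha) + Num.floor (n%:R * alpha) + 1)).
    by apply/andP; split; lra.
  by have := E m; have := E n; rewrite natrD mulrDl !intrD; lra.
Qed.

Lemma orbit1 (R : realType) (alpha : R) : 0 < alpha < 1 -> orbit alpha 1 = alpha.
Proof.
move=> /andP[a0 a1]; apply: (@fracpart_unique _ _ _ 0); last by rewrite mul1r addr0.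
by apply/andP; split; lra.
Qed.

Lemma orbit_gt0 (R : realType) (alpha : R) (n : nat) :
  irrational alpha -> (0 < n)%N -> 0 < orbit alpha n.
Proof.
move=> irr n0; have /andP[ge0 _] := orbit_itv alpha n.
rewrite lt_neqAle ge0 andbT; apply/eqP => o_eq0; apply: irr.
exists ((Num.floor (n%:R * alpha))%:Q / n%:Q) => //.
have /eqP := esym o_eq0; rewrite /orbit /fracpart subr_eq0 => /eqP floorE.
rewrite fmorph_div/= !ratr_int -floorE mulrC mulKf//.
by rewrite pnatr_eq0 -lt0n.
Qed.

Lemma orbit_mul_small (R : realType) (alpha : R) (q k : nat) :
  k%:R * orbit alpha q < 1 -> orbit alpha (k * q) = k%:R * orbit alpha q.
Proof.
move=> k1; have /andP[q0 _] := orbit_itv alpha q.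
apply: (@fracpart_unique _ _ _ (Num.floor (q%:R * alpha) *+ k)).
  by rewrite mulr_ge0.
rewrite natrM -mulrA rmorphMn/= -[X in _ + X]mulr_natl -mulrDr.
by rewrite /orbit /fracpart subrK.
Qed.

Lemma orbit_mul_near1 (R : realType) (alpha : R) (q k : nat) :
  0 < k%:R * (1 - orbit alpha q) <= 1 ->
  orbit alpha (k * q) = 1 - k%:R * (1 - orbit alpha q).
Proof.
move=> /andP[k0 k1].
apply: (@fracpart_unique _ _ _ (k%:Z - 1 + Num.floor (q%:R * alpha) *+ k)).
  by apply/andP; split; lra.
rewrite natrM -mulrA !intrD rmorphMn/= -[X in _ + (_ + X)]mulr_natl.
by rewrite /orbit /fracpart mulrNz pmulrn; ring.
Qed.

(** Among [m + 1] orbit points two lie in the same of the [m] boxes of length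
    [1 / m]; the difference of their indices moves every point by less than
    [1 / m], up or down. *)
Lemma orbit_pigeonhole (R : realType) (alpha : R) (m : nat) : (0 < m)%N ->
  exists2 q : nat, (0 < q)%N &
    orbit alpha q < m%:R^-1 \/ 1 - m%:R^-1 < orbit alpha q.
Proof.
case: m => // m _; set M : R := m.+1%:R.
have M0 : 0 < M by rewrite ltr0n.
pose box (i : 'I_m.+2) : 'I_m.+1 := inord (Num.truncn (M * orbit alpha i)).
have boxE (i : 'I_m.+2) :
    (box i)%:R / M <= orbit alpha i < (box i)%:R / M + M^-1.
  have /andP[i0 i1] := orbit_itv alpha i.
  have Mi0 : 0 <= M * orbit alpha i by rewrite mulr_ge0// ltW.
  rewrite /box inordK; last by rewrite truncn_lt_nat// -[ltRHS]mulr1 ltr_pM2l.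
  have /andP[lo hi] := truncn_itv Mi0.
  by rewrite -[X in _ + X]mul1r -mulrDl ler_pdivrMr// ltr_pdivlMr// natr1
     [orbit _ _ * _]mulrC lo hi.
have /injectivePn[i [j ij boxij]] : ~~ injectiveb box.
  by apply/negP => /injectiveP/leq_card; rewrite !card_ord ltnn.
wlog lt_ij : i j ij boxij / (i < j)%N.
  move=> wl; have [lt_ij|lt_ji|/val_inj eij] := ltngtP i j.
  - exact: (wl i j).
  - by apply: (wl j i) => //; rewrite eq_sym.
  - by rewrite eij eqxx in ij.
exists (j - i)%N; first by rewrite subn_gt0.
have /andP[jlo jhi] := boxE j; have /andP[] := boxE i; rewrite boxij => ilo ihi.
move: ilo ihi jlo jhi; move: (M^-1) (_ / M) => y x ilo ihi jlo jhi.
have := orbitD alpha i (j - i); rewrite subnKC 1?ltnW// => -[] ?; [left|right]; lra.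
Qed.

(** A [q] moving points by less than [v - u] makes its multiples step through
    the circle without jumping over the interval. *)
Lemma orbit_dense (R : realType) (alpha u v : R) :
  irrational alpha -> 0 <= u -> u < v -> v <= 1 ->
  exists2 q : nat, (0 < q)%N & u < orbit alpha q < v.
Proof.
move=> irr u0 uv v1.
pose m := (Num.truncn (v - u)^-1).+1.
have uv0 : 0 < v - u by rewrite subr_gt0.
have mlt : m%:R^-1 < v - u.
  by rewrite invf_plt ?posrE ?ltr0n// truncnS_gt.
have step (x th : R) : 0 <= x -> 0 < th ->
    exists2 k : nat, (0 < k)%N & x < k%:R * th <= x + th.
  move=> x0 th0; exists (Num.truncn (x / th)).+1 => //.
  have /andP[lo hi] := truncn_itv (divr_ge0 x0 (ltW th0)).
  rewrite ler_pdivlMr// in lo; rewrite ltr_pdivrMr// in hi.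
  by rewrite hi -natr1 mulrDl mul1r lerD2r lo.
have [//|q q0 [qlt|qgt]] := @orbit_pigeonhole R alpha m.
- have th0 := orbit_gt0 irr q0.
  have [k k0 /andP[klo khi]] := step u _ u0 th0.
  exists (k * q)%N; first by rewrite muln_gt0 k0.
  by rewrite orbit_mul_small; [apply/andP; split|]; lra.
- have /andP[_ q1] := orbit_itv alpha q.
  have [||k k0 /andP[klo khi]] := step (1 - v) (1 - orbit alpha q); [lra|lra|].
  exists (k * q)%N; first by rewrite muln_gt0 k0.
  by rewrite orbit_mul_near1; apply/andP; split; lra.
Qed.

(** * Equidistribution *)

(** Shifting the window by one index replaces a single term by another. *)
Lemma sum_shift_bound (R : realType) (f : nat -> R) (N q : nat) :
  (forall n, 0 <= f n <= 1) ->
  `|\sum_(0 <= n < N) f (n + q)%N - \sum_(0 <= n < N) f n| <= q%:R.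
Proof.
move=> f01; elim: q => [|q IH].
  by under eq_bigr do rewrite addn0; rewrite subrr normr0.
have step : \sum_(0 <= n < N) f (n + q.+1)%N - \sum_(0 <= n < N) f (n + q)%N
    = f (N + q)%N - f q.
  rewrite -sumrB -[q in RHS]/(0 + q)%N -(telescope_sumr (fun n => f (n + q)%N))//.
  by apply: eq_bigr => n _; rewrite addnS addSn.
have /andP[? ?] := f01 (N + q)%N; have /andP[? ?] := f01 q.
by move: IH; rewrite -natr1 !ler_norml => /andP[? ?]; apply/andP; split; lra.
Qed.

Lemma count_uptoE (R : realType) (P : nat -> Prop) (N : nat) :
  (count_upto P N)%:R = \sum_(0 <= n < N.+1) (`[< P n >])%:R :> R.
Proof.
rewrite /count_upto -sum1_count big_mkcond natr_sum /index_iota subn0.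
by apply: eq_bigr => n _; case: ifP.
Qed.

(** Adding [x_q] to [x_n] passes 1 exactly when the result is below [x_q], and
    [x_q + x_n - x_(n+q)] is the number of times 1 is passed.  Up to the
    constant [x_q] the indicator is thus a coboundary, and its sums telescope. *)
Lemma orbit_wrap_coboundary (R : realType) (alpha : R) (n q : nat) :
  (orbit alpha (n + q) < orbit alpha q)%R%:R =
    orbit alpha q + (orbit alpha n - orbit alpha (n + q)) :> R.
Proof.
have /andP[n0 n1] := orbit_itv alpha n.
by case: (orbitD alpha n q) => ->; case: ltP => /= ?; lra.
Qed.

(** One [q] pays for the telescoped coboundary, the other for replacing the
    shifted count of [n + q] by that of [n]. *)
Lemma orbit_discrepancy (R : realType) (alpha : R) (q N : nat) :
  `|(count_upto (fun n => orbit alpha n < orbit alpha q) N)%:R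
     - N.+1%:R * orbit alpha q| <= q%:R + q%:R.
Proof.
have wraps : \sum_(0 <= n < N.+1) (orbit alpha (n + q) < orbit alpha q)%R%:R =
    N.+1%:R * orbit alpha q + (\sum_(0 <= n < N.+1) orbit alpha n
      - \sum_(0 <= n < N.+1) orbit alpha (n + q)) :> R.
  under eq_bigr do rewrite orbit_wrap_coboundary.
  by rewrite big_split/= sumr_const_nat subn0 mulr_natl sumrB.
have orbit01 n : 0 <= orbit alpha n <= 1.
  by have /andP[-> /ltW ->] := orbit_itv alpha n.
have ind01 n : 0 <= ((orbit alpha n < orbit alpha q)%R%:R : R) <= 1.
  by case: ltP; rewrite /= ?lexx ?ler01.
have := sum_shift_bound N.+1 q ind01; have := sum_shift_bound N.+1 q orbit01.
rewrite count_uptoE wraps; under [X in `|X - _| <= q%:R + _]eq_bigr do rewrite asboolb.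
by rewrite !ler_norml => /andP[? ?] /andP[? ?]; apply/andP; split; lra.
Qed.

(** The natural density of [P]: [N.+1] is the number of indices up to [N]. *)
Definition has_density (R : realType) (P : nat -> Prop) (f : R) : Prop :=
  (fun N => (count_upto P N)%:R / N.+1%:R : R) @ \oo --> f.

(** Squeeze [c] between two orbit points within [e / 2] of it; their
    discrepancies are bounded, hence negligible against [N * e / 2]. *)
Lemma orbit_equidistributed (R : realType) (alpha c : R) :
  irrational alpha -> 0 <= c < 1 -> has_density (fun n => orbit alpha n < c) c.
Proof.
move=> irr /andP[c0 c1]; apply/cvgrPdist_le => e e0.
have count_mono (x y : R) N : x <= y ->
    (count_upto (fun n => orbit alpha n < x) N)%:R <=
    (count_upto (fun n => orbit alpha n < y) N)%:R :> R.
  move=> xy; rewrite ler_nat; apply: sub_count => n /= /asboolP xn.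
  by apply/asboolP; exact: lt_le_trans xn xy.
have h0 : 0 < e / 2 by rewrite divr_gt0.
have [q2 _ /andP[q2lo q2hi]] : exists2 q, (0 < q)%N &
    c < orbit alpha q < Num.min 1 (c + e / 2).
  by apply: orbit_dense; rewrite ?ge_min ?lexx// lt_min; apply/andP; split; lra.
have [K hK] : exists K : nat, forall N,
    N.+1%:R * (c - e / 2) - K%:R <=
      (count_upto (fun n => orbit alpha n < c) N)%:R :> R.
  have [cz|cnz] := eqVneq c 0.
    exists 0%N => N; rewrite cz subr0; apply: le_trans (ler0n _ _).
    by rewrite pmulr_rle0 ?ltr0n//; lra.
  have [q1 _ /andP[q1lo q1hi]] : exists2 q, (0 < q)%N &
      Num.max 0 (c - e / 2) < orbit alpha q < c.
    apply: orbit_dense; rewrite ?le_max ?lexx ?(ltW c1)//.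
    by rewrite gt_max lt_neqAle eq_sym cnz c0/=; lra.
  exists (q1 + q1)%N => N; apply: le_trans (count_mono _ _ N (ltW q1hi)).
  have := orbit_discrepancy alpha q1 N; rewrite ler_norml natrD => /andP[? _].
  have : N.+1%:R * (c - e / 2) <= N.+1%:R * orbit alpha q1.
    by rewrite ler_pM2l ?ltr0n//; move: q1lo; rewrite gt_max => /andP[_ /ltW].
  by lra.
have hi N : (count_upto (fun n => orbit alpha n < c) N)%:R <=
    N.+1%:R * (c + e / 2) + (q2 + q2)%:R.
  apply: (le_trans (count_mono _ _ N (ltW q2lo))).
  have := orbit_discrepancy alpha q2 N; rewrite ler_norml natrD => /andP[_ ?].
  have : N.+1%:R * orbit alpha q2 <= N.+1%:R * (c + e / 2).
    by rewrite ler_pM2l ?ltr0n//; move: q2hi; rewrite lt_min => /andP[_ /ltW].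
  by lra.
near=> N.
have N0 : 0 < N.+1%:R :> R by rewrite ltr0n.
have Nbig : (K + (q2 + q2))%:R <= N.+1%:R * (e / 2).
  rewrite -ler_pdivrMr//; apply: le_trans (_ : N%:R <= _); last by rewrite ler_nat.
  by near: N; exact: nbhs_infty_ger.
move: Nbig (hK N) (hi N); rewrite natrD.
have K0 : 0 <= K%:R :> R by [].
have q20 : 0 <= (q2 + q2)%:R :> R by [].
move=> Nbig lo up.
have le_up : (count_upto (fun n => orbit alpha n < c) N)%:R / N.+1%:R <= c + e.
  by rewrite ler_pdivrMr//; lra.
have ge_lo : c - e <= (count_upto (fun n => orbit alpha n < c) N)%:R / N.+1%:R.
  by rewrite ler_pdivlMr//; lra.
by rewrite ler_distlC ge_lo le_up.
Unshelve. all: by end_near. Qed.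

(** * Densities and gap frequencies *)

Lemma has_density_iff (R : realType) (P Q : nat -> Prop) (f : R) :
  (forall n, P n <-> Q n) -> has_density P f -> has_density Q f.
Proof. by move=> PQ; rewrite (_ : P = Q)//; apply/funext => n; exact/propext. Qed.

Lemma has_density_diff (R : realType) (P Q : nat -> Prop) (p q : R) :
  (forall n, P n -> Q n) -> has_density P p -> has_density Q q ->
  has_density (fun n => Q n /\ ~ P n) (q - p).
Proof.
move=> PQ dP dQ; rewrite /has_density.
rewrite (_ : (fun N => _) = (fun N => (count_upto Q N)%:R / N.+1%:R : R)
  \- (fun N => (count_upto P N)%:R / N.+1%:R : R)); first exact: cvgB.
apply/funext => N /=; rewrite -mulrBl; congr (_ / _).
rewrite !(count_uptoE R) -sumrB; apply: eq_bigr => n _.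
rewrite asbool_and asbool_neg; case: asboolP => Qn; case: asboolP => Pn /=;
  rewrite ?subrr ?subr0//.
by case: Qn; exact: PQ.
Qed.

Lemma has_density_witness (R : realType) (P : nat -> Prop) (f : R) :
  has_density P f -> 0 < f -> exists n, P n.
Proof.
move=> dP f0; apply: contrapT => /forallNP noP.
have [N _ /(_ N (leqnn N))/=] := cvgr_gt f dP _ f0.
rewrite (count_uptoE R) big1 ?mul0r ?ltxx// => n _.
by case: asboolP => // /noP.
Qed.

(** The hits themselves have density [beta], so a frequency relative to the
    hits is a density divided by [beta]. *)
Lemma gap_frequency_of_density (R : realType) (alpha beta f : R) (g : nat) :
  irrational alpha -> 0 < beta < 1 ->
  has_density (fun i => hits alpha beta i /\ gap_after alpha beta i g) f ->
  gap_frequency alpha beta g (f / beta).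
Proof.
move=> irr /andP[b0 b1] df.
have dh : has_density (hits alpha beta) beta.
  by apply: orbit_equidistributed => //; rewrite (ltW b0).
rewrite /gap_frequency (_ : (fun N => _) =
  (fun N => (count_upto (fun i => hits alpha beta i /\ gap_after alpha beta i g) N)%:R
    / N.+1%:R : R)
  \* (fun N => ((count_upto (hits alpha beta) N)%:R / N.+1%:R)^-1 : R)).
  by apply: cvgM df _; apply: cvgV dh; exact: lt0r_neq0.
by apply/funext => N /=; rewrite invf_div mulrA mulfVK.
Qed.

Lemma gap_after_uniq (R : realType) (alpha beta : R) (i g h : nat) :
  gap_after alpha beta i g -> gap_after alpha beta i h -> g = h.
Proof.
by move=> [ig ming] [ih minh]; have := ming _ ih; have := minh _ ig; lia.
Qed.

Lemma least_elt_exists (A : set nat) : (exists n, A n) -> exists n, least_elt A n.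
Proof.
move=> [n An]; have exA : exists n, `[< A n >] by exists n; exact/asboolP.
case: (ex_minnP exA) => m /asboolP Am minm; exists m; split=> // k Ak.
exact/minm/asboolP.
Qed.

(** * First return to the interval *)

Definition return_time (R : realType) (beta s t : R) (b d : nat) (x : R) : nat :=
  if x < beta - s then b else if x < t then (b + d)%N else d.

(** The facts on [b] and [d] which determine the first returns.  The bounds by
    [b + d] say that a rise smaller than [s] or a fall smaller than [t] takes
    at least [b + d] steps; they are part of the definition because [b] and [d]
    need not be the least indices of a rise and of a fall: the values
    [b = d = 1] are to be covered also when [s] or [t] equals [beta]. *)
Definition return_data (R : realType) (alpha beta s t : R) (b d : nat) : Prop :=
  [/\ (0 < b)%N /\ (0 < d)%N,
      s = orbit alpha b /\ t = 1 - orbit alpha d,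
      [/\ s <= beta, t <= beta & beta <= s + t],
      forall g, (0 < g)%N -> orbit alpha g < beta -> (b <= g)%N /\
        (orbit alpha g < s -> (b + d <= g)%N)
    & forall g, (0 < g)%N -> 1 - beta < orbit alpha g -> (d <= g)%N /\
        (1 - t < orbit alpha g -> (b + d <= g)%N)].

(** The claimed time is a return by adding the rise, the fall, or both.  It is
    the first one because any return by [g] moves [x] by [x_g] upwards or by
    [1 - x_g] downwards, and the zone of [x] bounds the size of that move. *)
Lemma return_timeP (R : realType) (alpha beta s t : R) (b d i : nat) :
  beta < 1 -> return_data alpha beta s t b d -> hits alpha beta i ->
  gap_after alpha beta i (return_time beta s t b d (orbit alpha i)).
Proof.
move=> b1 [[b0 d0] [sE tE] [sb tb bst] up down]; rewrite /hits/= -/(orbit alpha i).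
set x := orbit alpha i => xb.
have /andP[s0 s1] := orbit_itv alpha b; rewrite -sE in s0 s1.
have /andP[t1 t0] := orbit_itv alpha d.
have /andP[x0 x1] := orbit_itv alpha i; rewrite -/x in x0 x1.
split=> [|j [hj lt_ij]].
  split; last first.
    rewrite -{1}[i]addn0 ltn_add2l /return_time.
    by do 2?[case: ifP => _]; rewrite ?addn_gt0 ?b0.
  rewrite /hits/= -/(orbit _ _) /return_time.
  have [xs|xs] := ltP x (beta - s); last have [xt|xt] := ltP x t.
  - have /andP[? ?] := orbit_itv alpha (i + b).
    by case: (orbitD alpha i b); rewrite -/x -sE; lra.
  - rewrite [(b + d)%N]addnC addnA.
    have /andP[? ?] := orbit_itv alpha (i + d).
    have /andP[? ?] := orbit_itv alpha (i + d + b).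
    by case: (orbitD alpha (i + d) b); case: (orbitD alpha i d); rewrite -/x -sE; lra.
  - have /andP[? ?] := orbit_itv alpha (i + d).
    by case: (orbitD alpha i d); rewrite -/x; lra.
move: hj; rewrite /hits/= -/(orbit _ _) -(subnKC (ltnW lt_ij)) leq_add2l.
have : (0 < j - i)%N by rewrite subn_gt0.
move: (j - i)%N => g g0; have /andP[? ?] := orbit_itv alpha (i + g).
have /andP[? ?] := orbit_itv alpha g.
case: (orbitD alpha i g); rewrite -/x => yE yb.
- have [bg bdg] : (b <= g)%N /\ (orbit alpha g < s -> (b + d <= g)%N).
    by apply: up => //; lra.
  rewrite /return_time; have [//|xs] := ltP x (beta - s).
  have {}bdg := bdg ltac:(lra).
  by case: ifP => // _; exact: leq_trans (leq_addl _ _) bdg.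
- have [dg bdg] : (d <= g)%N /\ (1 - t < orbit alpha g -> (b + d <= g)%N).
    by apply: down => //; lra.
  rewrite /return_time; have [xs|_] := ltP x (beta - s).
    by apply: leq_trans (leq_addr d _) (bdg _); lra.
  by have [xt|//] := ltP x t; apply: bdg; lra.
Qed.

(** * Density of each gap *)

Definition starts_gap (R : realType) (alpha beta : R) (g i : nat) : Prop :=
  hits alpha beta i /\ gap_after alpha beta i g.

Lemma starts_gapE (R : realType) (alpha beta s t : R) (b d g i : nat) :
  beta < 1 -> return_data alpha beta s t b d ->
  starts_gap alpha beta g i <->
    orbit alpha i < beta /\ return_time beta s t b d (orbit alpha i) = g.
Proof.
move=> b1 rd; split=> [[hi gi]|[hi <-]]; split=> //.
  exact: gap_after_uniq (return_timeP b1 rd hi) gi.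
exact: return_timeP b1 rd hi.
Qed.

Lemma gaps_sub_return (R : realType) (alpha beta s t : R) (b d : nat) :
  beta < 1 -> return_data alpha beta s t b d ->
  gaps alpha beta `<=` [set b; d; (b + d)%N].
Proof.
move=> b1 rd g [i hi gi].
rewrite -(gap_after_uniq (return_timeP b1 rd hi) gi) /return_time /=.
by case: ifP => _; [left; left|case: ifP => _; [right|left; right]].
Qed.

(** The gap [b + d] marks the middle zone [[beta - s, t)]. *)
Lemma density_gapD (R : realType) (alpha beta s t : R) (b d : nat) :
  irrational alpha -> beta < 1 -> return_data alpha beta s t b d ->
  has_density (starts_gap alpha beta (b + d)) (s + t - beta).
Proof.
move=> irr b1 rd; have [[b0 d0] [sE tE] [sb tb bst] _ _] := rd.
have /andP[s0 _] := orbit_itv alpha b; rewrite -sE in s0.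
have /andP[_ t0] := orbit_itv alpha d.
rewrite (_ : s + t - beta = t - (beta - s)); last by lra.
apply: (@has_density_iff _
    (fun i => orbit alpha i < t /\ ~ orbit alpha i < beta - s)).
  move=> i; rewrite (starts_gapE _ _ b1 rd) /return_time.
  have [xs|xs] := ltP (orbit alpha i) (beta - s).
    split=> [[_ /(_ isT)]//|[_ /eqP]].
    by rewrite -[eqbLHS]addn0 eqn_add2l eq_sym -leqn0 leqNgt d0.
  have [xt|xt] := ltP (orbit alpha i) t.
    by split=> // _; split=> //; exact: lt_le_trans xt tb.
  by split=> [[]//|[_ /eqP]]; rewrite -[eqbLHS]add0n eqn_add2r eq_sym -leqn0 leqNgt b0.
apply: has_density_diff.
- by move=> n /lt_le_trans; apply; lra.
- by apply: orbit_equidistributed => //; apply/andP; split; lra.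
- by apply: orbit_equidistributed => //; apply/andP; split; lra.
Qed.

Lemma density_gap_up (R : realType) (alpha beta s t : R) (b d : nat) :
  irrational alpha -> beta < 1 -> return_data alpha beta s t b d -> b <> d ->
  has_density (starts_gap alpha beta b) (beta - s).
Proof.
move=> irr b1 rd bd; have [[b0 d0] [sE _] [sb _ _] _ _] := rd.
have /andP[s0 _] := orbit_itv alpha b; rewrite -sE in s0.
apply: (@has_density_iff _ (fun i => orbit alpha i < beta - s)); last first.
  by apply: orbit_equidistributed => //; apply/andP; split; lra.
move=> i; rewrite (starts_gapE _ _ b1 rd) /return_time.
have [xs|xs] := ltP (orbit alpha i) (beta - s).
  by split=> // _; split=> //; apply: lt_le_trans xs _; lra.
split=> // -[_]; case: ifP => _ E; last by case: bd.
by move: d0; rewrite -(ltn_add2l b) E addn0 ltnn.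
Qed.

Lemma density_gap_down (R : realType) (alpha beta s t : R) (b d : nat) :
  irrational alpha -> beta < 1 -> return_data alpha beta s t b d -> b <> d ->
  has_density (starts_gap alpha beta d) (beta - t).
Proof.
move=> irr b1 rd bd; have [[b0 d0] [sE tE] [sb tb bst] _ _] := rd.
have /andP[s0 _] := orbit_itv alpha b; rewrite -sE in s0.
have /andP[_ t0] := orbit_itv alpha d.
apply: (@has_density_iff _ (fun i => orbit alpha i < beta /\ ~ orbit alpha i < t)).
  move=> i; rewrite (starts_gapE _ _ b1 rd) /return_time.
  have [xs|xs] := ltP (orbit alpha i) (beta - s).
    split=> [[_ []]|[_ //]]; apply: lt_le_trans xs _; lra.
  have [xt|xt] := ltP (orbit alpha i) t; last by split=> -[].
  split=> -[xb]; first by move=> /(_ isT).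
  by move=> E; move: b0; rewrite -(ltn_add2r d) E add0n ltnn.
apply: has_density_diff.
- by move=> n /lt_le_trans; apply.
- by apply: orbit_equidistributed => //; apply/andP; split; lra.
- by apply: orbit_equidistributed => //; apply/andP; split; lra.
Qed.

(** If [b = d] the two outer zones give the same gap, whose density is the
    complement of that of the middle zone in [[0, beta)]. *)
Lemma density_gap_both (R : realType) (alpha beta s t : R) (b : nat) :
  irrational alpha -> 0 < beta < 1 -> return_data alpha beta s t b b ->
  has_density (starts_gap alpha beta b) (beta - (s + t - beta)).
Proof.
move=> irr /andP[beta0 b1] rd; have [[b0 _] _ _ _ _] := rd.
apply: (@has_density_iff _
    (fun i => orbit alpha i < beta /\ ~ starts_gap alpha beta (b + b) i)).
  have bbb : (b + b)%N <> b.
    by move=> E; move: b0; rewrite -(ltn_add2l b) E addn0 ltnn.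
  move=> i; rewrite !(starts_gapE _ _ b1 rd); split=> -[xb].
    rewrite /return_time => nbb; split=> //.
    by case: ifP nbb => // _; case: ifP => // _ [].
  by move=> ->; split=> // -[_ /esym].
apply: has_density_diff (density_gapD irr b1 rd) _; first by move=> i [].
by apply: orbit_equidistributed => //; rewrite (ltW beta0).
Qed.

Lemma gaps_of_density (R : realType) (alpha beta f : R) (g : nat) :
  has_density (starts_gap alpha beta g) f -> 0 < f -> gaps alpha beta g.
Proof. by move=> df /(has_density_witness df)[i [hi gi]]; exists i. Qed.

(** * Return data in the two ranges of the interval length *)

(** The bounds by [b + d = 2] hold because the only smaller index, 1, moves
    points by exactly [s] upwards, equivalently by [t] downwards. *)
Lemma return_data_wide (R : realType) (alpha beta : R) :
  0 < alpha < 1 -> Num.max alpha (1 - alpha) <= beta ->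
  beta < 1 -> return_data alpha beta alpha (1 - alpha) 1 1.
Proof.
move=> a01; rewrite ge_max => /andP[ab ab'] b1.
have a1 := orbit1 a01; split=> //.
- by rewrite a1.
- by split=> //; lra.
- move=> g g0 _; split=> // ga; case: g g0 ga => [|[|g]]// _.
  by rewrite a1 ltxx.
- move=> g g0 _; split=> // ga; case: g g0 ga => [|[|g]]// _.
  by rewrite a1 => ?; exfalso; lra.
Qed.

(** If [b = d = 1] then [alpha] and [1 - alpha] are below [beta]; if
    [b = d > 1] then the index 1 is neither a rise nor a fall, that is
    [beta <= alpha <= 1 - beta], whereas [1 - beta < x_b < beta].  The other
    facts come from subtracting the smaller index from the larger: if
    [s + t < beta], or if some move smaller than [s] or [t] came too early, the
    difference would be the index of a rise before [b] or of a fall before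
    [d]. *)
Lemma return_data_narrow (R : realType) (alpha beta : R) (b d : nat) :
  0 < alpha < 1 -> 0 < beta < 1 -> beta < Num.max alpha (1 - alpha) ->
  least_elt [set n | (0 < n)%N /\ fracpart (n%:R * alpha) < beta] b ->
  least_elt [set n | (0 < n)%N /\ 1 - beta < fracpart (n%:R * alpha)] d ->
  b <> d /\
  return_data alpha beta (orbit alpha b) (1 - orbit alpha d) b d.
Proof.
move=> a01 /andP[beta0 beta1]; rewrite lt_max => bmax.
move=> [/= [b0 sb] minb] [/= [d0 td] mind].
rewrite -/(orbit alpha b) in sb; rewrite -/(orbit alpha d) in td.
have {}minb n : (0 < n)%N -> orbit alpha n < beta -> (b <= n)%N.
  by move=> ? ?; exact: minb.
have {}mind n : (0 < n)%N -> 1 - beta < orbit alpha n -> (d <= n)%N.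
  by move=> ? ?; exact: mind.
have a1 := orbit1 a01.
have bd : b <> d.
  move=> bd; have [b1|b1] := ltnP 1 b.
    have ba : beta <= alpha.
      by rewrite leNgt -a1; apply/negP => /(minb 1%N isT); rewrite leqNgt b1.
    have ab : alpha <= 1 - beta.
      by rewrite leNgt -a1; apply/negP => /(mind 1%N isT); rewrite -bd leqNgt b1.
    by rewrite -bd in td; lra.
  have bE : b = 1%N by apply/eqP; rewrite eqn_leq b1.
  rewrite -bd bE a1 in td; rewrite bE a1 in sb.
  by case/orP: bmax; lra.
split=> //; have /andP[s0 s1] := orbit_itv alpha b.
have /andP[t1 t0] := orbit_itv alpha d.
split=> //.
- split; [lra|lra|]; rewrite leNgt; apply/negP => stb.
  have [lt_bd|lt_db|//] := ltngtP b d.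
    have /andP[w0 w1] := orbit_itv alpha (d - b).
    (* [x_(d - b) = 1 - (s + t)] would be a fall before [d] *)
    have : (d <= d - b)%N; last by rewrite leqNgt ltn_subrL b0 d0.
    apply: mind; rewrite ?subn_gt0//.
    by have := orbitD alpha (d - b) b; rewrite subnK 1?ltnW// => -[]; lra.
  have /andP[w0 w1] := orbit_itv alpha (b - d).
  (* [x_(b - d) = s + t] would be a rise before [b] *)
  have : (b <= b - d)%N; last by rewrite leqNgt ltn_subrL b0 d0.
  apply: minb; rewrite ?subn_gt0//.
  by have := orbitD alpha (b - d) d; rewrite subnK 1?ltnW// => -[]; lra.
- move=> g g0 gb; have bg := minb _ g0 gb; split=> // gs.
  have lt_bg : (b < g)%N.
    by rewrite ltn_neqAle bg andbT; apply: contraTneq gs => <-; rewrite ltxx.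
  have /andP[w0 w1] := orbit_itv alpha (g - b).
  have /andP[g'0 g'1] := orbit_itv alpha g.
  (* [g - b] is a fall, by [s - x_g] *)
  rewrite -leq_subRL//; apply: mind; rewrite ?subn_gt0//.
  by have := orbitD alpha (g - b) b; rewrite subnK// => -[]; lra.
- move=> g g0 gd; have dg := mind _ g0 gd; split=> // gt.
  have lt_dg : (d < g)%N.
    by rewrite ltn_neqAle dg andbT; apply: contraTneq gt => <-; rewrite subKr ltxx.
  have /andP[w0 w1] := orbit_itv alpha (g - d).
  have /andP[g'0 g'1] := orbit_itv alpha g.
  (* [g - d] is a rise, by [x_g - (1 - t)] *)
  rewrite addnC -leq_subRL//; apply: minb; rewrite ?subn_gt0//.
  by have := orbitD alpha (g - d) d; rewrite subnK// => -[]; lra.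
Qed.

(** * The three gaps *)

Lemma card_le_triple (b d : nat) (A : set nat) :
  A `<=` [set b; d; (b + d)%N] -> (A #<= `I_3)%card.
Proof.
move=> Asub; pose f (k : nat) := nth (b + d)%N [:: b; d] k.
apply: card_le_trans (card_image_le f `I_3).
apply: subset_card_le => g /Asub [[->|->]|->].
- by exists 0%N.
- by exists 1%N.
- by exists 2%N.
Qed.

Lemma distinct_triple_sum (b d g1 g2 g3 : nat) :
  [set b; d; (b + d)%N] g1 -> [set b; d; (b + d)%N] g2 ->
  [set b; d; (b + d)%N] g3 -> g1 <> g2 -> g1 <> g3 -> g2 <> g3 ->
  g1 = (g2 + g3)%N \/ g2 = (g1 + g3)%N \/ g3 = (g1 + g2)%N.
Proof. by move=> [[]|] -> [[]|] -> [[]|] ->; lia. Qed.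

Theorem theorem2 (R : realType) (alpha beta : R)
    (halpha : 0 < alpha < 1) (hbeta : 0 < beta < 1)
    (hirr : irrational alpha) :
  (forall i : nat, hits alpha beta i -> exists g : nat, gap_after alpha beta i g) /\
  (gaps alpha beta #<= `I_3)%card /\
  (forall g1 g2 g3 : nat,
     gaps alpha beta g1 -> gaps alpha beta g2 -> gaps alpha beta g3 ->
     g1 <> g2 -> g1 <> g3 -> g2 <> g3 ->
     g1 = (g2 + g3)%N \/ g2 = (g1 + g3)%N \/ g3 = (g1 + g2)%N) /\
  (Num.max alpha (1 - alpha) <= beta ->
     gaps alpha beta = [set 1%N; 2%N] /\
     gap_frequency alpha beta 1 ((2 * beta - 1) / beta) /\
     gap_frequency alpha beta 2 ((1 - beta) / beta)) /\
  (beta < Num.max alpha (1 - alpha) ->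
     exists b d : nat,
       least_elt [set n | (0 < n)%N /\ fracpart (n%:R * alpha) < beta] b /\
       least_elt [set n | (0 < n)%N /\ 1 - beta < fracpart (n%:R * alpha)] d /\
       let s := fracpart (b%:R * alpha) in
       let t := 1 - fracpart (d%:R * alpha) in
       gaps alpha beta `<=` [set b; d; (b + d)%N] /\
       gaps alpha beta b /\
       gaps alpha beta d /\
       (gaps alpha beta (b + d)%N <-> beta < s + t) /\
       gap_frequency alpha beta b ((beta - s) / beta) /\
       gap_frequency alpha beta d ((beta - t) / beta) /\
       gap_frequency alpha beta (b + d)%N ((s + t - beta) / beta)).
Proof.
have /andP[beta0 beta1] := hbeta.
have least_returns : exists b d : nat,
    least_elt [set n | (0 < n)%N /\ fracpart (n%:R * alpha) < beta] b /\
    least_elt [set n | (0 < n)%N /\ 1 - beta < fracpart (n%:R * alpha)] d.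
  have [|b hb] := @least_elt_exists
      [set n | (0 < n)%N /\ fracpart (n%:R * alpha) < beta].
    have [q q0 /andP[_ ?]] := orbit_dense hirr (lexx 0) beta0 (ltW beta1).
    by exists q.
  have [|d hd] := @least_elt_exists
      [set n | (0 < n)%N /\ 1 - beta < fracpart (n%:R * alpha)].
    have [||q q0 /andP[? _]] := @orbit_dense R alpha (1 - beta) 1 hirr _ _ (lexx 1).
    - by rewrite subr_ge0 ltW.
    - by rewrite gtrBl.
    by exists q.
  by exists b, d.
have [s [t [b [d rd]]]] : exists s t b d, return_data alpha beta s t b d.
  have [wide|narrow] := leP (Num.max alpha (1 - alpha)) beta.
    by exists alpha, (1 - alpha), 1%N, 1%N; exact: return_data_wide.
  have [b [d [hb hd]]] := least_returns.
  exists (orbit alpha b), (1 - orbit alpha d), b, d.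
  by have [] := return_data_narrow halpha hbeta narrow hb hd.
have sub := gaps_sub_return beta1 rd.
split=> [i hi|]; first by eexists; exact: return_timeP beta1 rd hi.
split; first exact: card_le_triple sub.
split=> [g1 g2 g3 /sub ? /sub ? /sub ? ? ? ?|]; first exact: (@distinct_triple_sum b d).
move: sub => _; clear s t b d rd; split=> [wide|narrow].
- have rd := return_data_wide halpha wide beta1.
  have d1 := density_gap_both hirr hbeta rd; have d2 := density_gapD hirr beta1 rd.
  have half : 1 < 2 * beta.
    (* [max (alpha, 1 - alpha) > 1 / 2], as [alpha] is not 1 / 2 *)
    have aneq : alpha != 1 - alpha.
      apply/eqP => aE; apply: hirr; exists (2%:Q^-1) => //.
      rewrite fmorphV/= ratr_nat; have -> : alpha = 1 / 2 by lra.
      by rewrite div1r.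
    by move: wide; rewrite ge_max => /andP[]; case: ltgtP aneq; lra.
  rewrite (_ : beta - _ = 2 * beta - 1) in d1; last by lra.
  rewrite (_ : _ - beta = 1 - beta) in d2; last by lra.
  split; last by split; exact: gap_frequency_of_density.
  apply/seteqP; split=> [g /(gaps_sub_return beta1 rd) [[->|->]|->]|g [->|->]].
  + by left.
  + by left.
  + by right.
  + by apply: gaps_of_density d1 _; lra.
  + by apply: gaps_of_density d2 _; lra.
have [b [d [hb hd]]] := least_returns; exists b, d; split=> //; split=> //.
rewrite /= -/(orbit alpha b) -/(orbit alpha d).
have [bd rd] := return_data_narrow halpha hbeta narrow hb hd.
have db := density_gap_up hirr beta1 rd bd.
have dd := density_gap_down hirr beta1 rd bd.
have dbd := density_gapD hirr beta1 rd.
have [_ sb] := hb.1; have [_ td] := hd.1.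
rewrite -/(orbit alpha b) in sb; rewrite -/(orbit alpha d) in td.
split; first exact: gaps_sub_return beta1 rd.
split; first by apply: gaps_of_density db _; lra.
split; first by apply: gaps_of_density dd _; lra.
split.
  split=> [[i hi gi]|st]; last by apply: gaps_of_density dbd _; lra.
  have [[b0 d0] _ _ _ _] := rd.
  have := gap_after_uniq (return_timeP beta1 rd hi) gi; rewrite /return_time.
  have [_ E|xs] := ltP (orbit alpha i) _.
    by move: d0; rewrite -(ltn_add2l b) -E addn0 ltnn.
  have [xt _|_ E] := ltP (orbit alpha i) _; last first.
    by move: b0; rewrite -(ltn_add2r d) -E add0n ltnn.
  by move: xs xt; lra.
by do 2?split; exact: gap_frequency_of_density.
Qed.
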